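(* Let $S_0$ and $S_1$ be isometries on a Hilbert space $\mathcal{H}$ satisfying $S_0S_0^*+S_1S_1^*=I$. Then there exists a representation $\pi$ of $\mathcal{Q}_2$ on $\mathcal{H}$ with $$\pi(s_2)=S_0\quad\text{and}\quad \pi(us_2)=S_1$$ if and only if the unitary parts in the Wold decompositions of $S_0$ and $S_1$ are unitarily equivalent.
   Context: $\mathcal{Q}_2$ denotes the universal unital $C^*$-algebra generated by a unitary $u$ and an isometry $s_2$ subject to the relations $s_2u=u^2s_2$ and $s_2s_2^*+us_2s_2^*u^{-1}=1$. Representations are unital $*$-representations. The unitary part of an isometry $S$ on a Hilbert space is the restriction of $S$ to the $S$-invariant subspace $\bigcap_{n=1}^\infty \operatorname{im}(S^n)$ (which may be zero). *)

(* Defs.v *)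
From HB Require Import structures.
From mathcomp Require Import all_boot all_order all_algebra.
From mathcomp Require Import sesquilinear.
From mathcomp Require Import complex.
From mathcomp Require Import boolp classical_sets functions reals.
From mathcomp Require Import topology normedtype.

Set Implicit Arguments.
Unset Strict Implicit.
Unset Printing Implicit Defensive.

Import Order.TTheory GRing.Theory Num.Theory.
Import numFieldNormedType.Exports.

Local Open Scope classical_set_scope.
Local Open Scope ring_scope.

(* Complex Hilbert spaces.  The inner product is linear in its first argument
   and conjugate-linear in the second; completeness is that of the norm. *)
HB.mixin Record CompleteNormedModule_isHilbert (R : realType) H
    & CompleteNormedModule R[i] H := {
  inner : {dot H for (@Num.conj R[i])};
  normr_inner : forall x : H, `|x| ^+ 2 = inner x x
}.

#[short(type="hilbertType")]
HB.structure Definition Hilbert (R : realType) :=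
  {H of CompleteNormedModule R[i] H & CompleteNormedModule_isHilbert R H}.

(* Unital C*-algebras.  The multiplication and unit are fields of the structure
   rather than inherited: a ring structure cannot be joined to a normed space
   without going through numDomainType.  The zero algebra is allowed. *)
HB.mixin Record CompleteNormedModule_isCStar (R : realType) A
    & CompleteNormedModule R[i] A := {
  cone : A;
  cmul : A -> A -> A;
  star : A -> A;
  cmulA : associative cmul;
  cmul1l : left_id cone cmul;
  cmul1r : right_id cone cmul;
  cmulDl : left_distributive cmul +%R;
  cmulDr : right_distributive cmul +%R;
  cmulZl : forall (l : R[i]) (a b : A), cmul (l *: a) b = l *: cmul a b;
  cmulZr : forall (l : R[i]) (a b : A), cmul a (l *: b) = l *: cmul a b;
  starK : involutive star;
  starD : {morph star : a b / a + b};
  starZ : forall (l : R[i]) (a : A), star (l *: a) = Num.conj l *: star a;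
  starM : forall a b : A, star (cmul a b) = cmul (star b) (star a);
  cstar_normM : forall a b : A, `|cmul a b| <= `|a| * `|b|;
  cstar_identity : forall a : A, `|cmul (star a) a| = `|a| ^+ 2
}.

#[short(type="cstarType")]
HB.structure Definition CStar (R : realType) :=
  {A of CompleteNormedModule R[i] A & CompleteNormedModule_isCStar R A}.

Notation "a ** b" := (cmul a b) (at level 40, left associativity) : ring_scope.

Record star_morphism (R : realType) (A B : cstarType R) (f : A -> B) : Prop := {
  star_morphism_linear : linear f;
  star_morphismM : forall a b : A, f (a ** b) = f a ** f b;
  star_morphism1 : f cone = cone;
  star_morphism_star : forall a : A, f (star a) = star (f a)
}.

Record star_subalgebra (R : realType) (A : cstarType R) (D : set A) : Prop := {
  star_subalgebra1 : D cone;
  star_subalgebra_lin : forall (l : R[i]) (a b : A), D a -> D b -> D (l *: a + b);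
  star_subalgebraM : forall a b : A, D a -> D b -> D (a ** b);
  star_subalgebra_star : forall a : A, D a -> D (star a)
}.

Definition generated_by (R : realType) (A : cstarType R) (G : set A) : Prop :=
  forall D : set A, star_subalgebra D -> closed D -> G `<=` D -> D = [set: A].

(* In the last relation, star u is the inverse of the unitary u. *)
Record Q2_relations (R : realType) (A : cstarType R) (u s : A) : Prop := {
  Q2_unitaryl : star u ** u = cone;
  Q2_unitaryr : u ** star u = cone;
  Q2_isometry : star s ** s = cone;
  Q2_commutation : s ** u = u ** u ** s;
  Q2_range_sum : s ** star s + u ** s ** star s ** star u = cone
}.

(* (A, u, s) is the C*-algebra Q_2 with its canonical generators u and s_2; this
   determines it up to a unique isomorphism.  The *-morphism given by
   universality is unique because u and s generate A. *)
Record is_Q2 (R : realType) (A : cstarType R) (u s : A) : Prop := {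
  is_Q2_relations : Q2_relations u s;
  is_Q2_generated : generated_by [set u; s];
  is_Q2_universal : forall (B : cstarType R) (v t : B), Q2_relations v t ->
    exists f : A -> B, [/\ star_morphism f, f u = v & f s = t]
}.

Section operators.
Variables (R : realType) (H : hilbertType R).
Implicit Types (S T W : H -> H) (K L : set H).

(* T is the Hilbert space adjoint of S. *)
Definition is_adjoint S T : Prop :=
  forall x y : H, inner (S x) y = inner x (T y).

Definition is_isometry S : Prop := linear S /\ forall x : H, `|S x| = `|x|.

(* A unital *-homomorphism from A to the bounded operators on H. *)
Record is_representation (A : cstarType R) (pi : A -> H -> H) : Prop := {
  representation_op_linear : forall a : A, linear (pi a);
  representation_op_bounded : forall a : A, continuous (pi a);
  representation_linear : linear pi;
  representationM : forall a b : A, pi (a ** b) = pi a \o pi b;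
  representation1 : pi cone = id;
  representation_star : forall a : A, is_adjoint (pi a) (pi (star a))
}.

Definition unitary_part_space S : set H :=
  \bigcap_(n in [set n : nat | (0 < n)%N]) range (iter n S).

(* W, of which only the values on K matter, is a unitary map from K onto L. *)
Record is_unitary_between K L W : Prop := {
  unitary_between_lin : forall (l : R[i]) (x y : H), K x -> K y ->
    W (l *: x + y) = l *: W x + W y;
  unitary_between_inner : forall x y : H, K x -> K y ->
    inner (W x) (W y) = inner x y;
  unitary_between_onto : W @` K = L
}.

(* The restrictions of S to K and of T to L are unitarily equivalent; K and L
   are meant to be closed subspaces invariant under S and T respectively. *)
Definition unitarily_equivalent K S L T : Prop :=
  exists W, is_unitary_between K L W /\ forall x : H, K x -> W (S x) = T (W x).

Definition unitary_parts_equivalent S T : Prop :=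
  unitarily_equivalent (unitary_part_space S) S (unitary_part_space T) T.

End operators.

(* Main.v *)
(* If pi is a representation of Q_2, then u^* s_2 = (u s_2) u^*, so the unitary
   pi(u)^* conjugates S_0 to S_1 and identifies their unitary parts.

   Conversely, S_0 H is the wandering subspace of S_1, so that H is the sum of
   the spaces S_1^n S_0 H and of the space K_1 of the unitary part of S_1.  Let
   U map S_1^n S_0 x to S_0^n S_1 x (addition of 1 to a binary expansion) and be
   the inverse V of the given equivalence on K_1.  In a formula,
     U x = sum_n S_0^n S_1 S_0^* S_1^*^n x + V P x,  P = lim_n S_1^n S_1^*^n.
   Then U S_0 = S_1 and U S_1 = S_0 U, and the adjoint of U is given by the same
   formula with S_0 and S_1 exchanged.  Universality of Q_2 is applied to the
   C*-algebra of bounded adjointable operators on H. *)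
Require Import Defs.
From HB Require Import structures.
From mathcomp Require Import all_boot all_order all_algebra.
From mathcomp Require Import sesquilinear complex.
From mathcomp Require Import boolp classical_sets functions reals.
From mathcomp Require Import topology normedtype sequences.
Import numFieldNormedType.Exports.
Local Open Scope classical_set_scope.
Local Open Scope ring_scope.

Set Implicit Arguments.
Unset Strict Implicit.
Unset Printing Implicit Defensive.
Import Order.TTheory GRing.Theory Num.Theory.

(** * Complex Hilbert spaces *)

Section linear_lemmas.
Context {K : pzRingType} {U V : lmodType K} {f : U -> V}.
Hypothesis lf : linear f.

Lemma linD x y : f (x + y) = f x + f y.
Proof. by have := lf 1 x y; rewrite !scale1r. Qed.

Lemma lin0 : f 0 = 0.
Proof. by apply: (addrI (f 0)); rewrite -linD !addr0. Qed.

Lemma linZ l x : f (l *: x) = l *: f x.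
Proof. by have := lf l x 0; rewrite lin0 !addr0. Qed.

Lemma linN x : f (- x) = - f x.
Proof. by rewrite -!scaleN1r linZ. Qed.

Lemma linB x y : f (x - y) = f x - f y.
Proof. by rewrite linD linN. Qed.

Lemma lin_sum n (F : nat -> U) : f (\sum_(k < n) F k) = \sum_(k < n) f (F k).
Proof. by elim: n => [|n IH]; rewrite ?big_ord0 ?lin0 // !big_ord_recr /= linD IH. Qed.

End linear_lemmas.

Lemma linear_iter (K : pzRingType) (U : lmodType K) (f : U -> U) n :
  linear f -> linear (iter n f).
Proof. by move=> lf; elim: n => [|n IH] a x y //=; rewrite IH lf. Qed.

Section hilbert.
Context {R : realType} {H : hilbertType R}.
Implicit Types (x y z : H) (S T : H -> H).

Lemma innerC x y : inner x y = Num.conj (inner y x).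
Proof. by rewrite hermC expr0 mul1r. Qed.

Lemma innerDl x y z : inner (x + y) z = inner x z + inner y z.
Proof. exact: linearDl. Qed.
Lemma innerDr x y z : inner x (y + z) = inner x y + inner x z.
Proof. exact: linearDr. Qed.
Lemma innerBl x y z : inner (x - y) z = inner x z - inner y z.
Proof. exact: linearBl. Qed.
Lemma innerBr x y z : inner x (y - z) = inner x y - inner x z.
Proof. exact: linearBr. Qed.
Lemma innerZl a x y : inner (a *: x) y = a * inner x y.
Proof. exact: linearZl_LR. Qed.
Lemma innerZr a x y : inner x (a *: y) = Num.conj a * inner x y.
Proof. exact: linearZr_LR. Qed.
Lemma inner0l x : inner 0 x = 0. Proof. exact: linear0l. Qed.
Lemma inner0r x : inner x 0 = 0. Proof. exact: linear0r. Qed.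

Lemma innerI x y : (forall z, inner x z = inner y z) -> x = y.
Proof.
move=> xy; apply/eqP; rewrite -subr_eq0 -normr_eq0 -sqrf_eq0 normr_inner.
by rewrite innerBl xy subrr.
Qed.

Lemma normr_le_inner x y : (`|x| <= `|y|) = (inner x x <= inner y y).
Proof. by rewrite -!normr_inner ler_sqr ?nnegrE. Qed.

Lemma normr_eq_inner x y : inner x x = inner y y -> `|x| = `|y|.
Proof. by move=> e; apply/eqP; rewrite eq_le !normr_le_inner e lexx. Qed.

Lemma cauchy_schwarz x y : `|inner x y| <= `|x| * `|y|.
Proof.
have [->|y0] := eqVneq y 0; first by rewrite inner0r !normr0 mulr0.
have ny : inner y y != 0 by rewrite -normr_inner sqrf_eq0 normr_eq0.
rewrite -ler_sqr ?nnegrE ?mulr_ge0 // exprMn !normr_inner.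
(* [c *: y] is the orthogonal projection of [x] onto the line of [y]; the inequality is
   [0 <= |x - c y|^2]. *)
pose c := inner x y / inner y y.
have cn : c * inner y y = inner x y by rewrite divfK.
have : 0 <= `|x - c *: y| ^+ 2 by rewrite exprn_ge0.
rewrite normr_inner innerBl !innerBr !innerZl !innerZr mulrCA cn opprB.
rewrite addrA subrK (innerC y x) subr_ge0 => le_cx.
have y2 : 0 <= inner y y by rewrite -normr_inner exprn_ge0.
have := ler_wpM2r y2 le_cx.
by rewrite mulrAC cn -normCK.
Qed.

Lemma pythagoras x y : inner x y = 0 -> `|x + y| ^+ 2 = `|x| ^+ 2 + `|y| ^+ 2.
Proof. by move=> xy; rewrite !normr_inner hnormDd. Qed.

Section cvg_inner.
Context {I : Type} {F : set_system I} {FF : Filter F}.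

Lemma cvg_innerl (f : I -> H) x y :
  f @ F --> x -> (fun i => inner (f i) y : R[i]^o) @ F --> (inner x y : R[i]^o).
Proof.
move=> fx; apply/cvgrPdist_le => /= e e0.
have e1 : 0 < e / (`|y| + 1) by rewrite divr_gt0 // ltr_wpDl.
move/cvgrPdist_le : fx => /(_ _ e1); apply: filterS => i xi.
rewrite -innerBl; apply: (le_trans (cauchy_schwarz _ _)).
apply: le_trans (_ : e / (`|y| + 1) * (`|y| + 1) <= _).
  by rewrite ler_pM // lerDl.
by rewrite divfK // gt_eqF // ltr_wpDl.
Qed.

Lemma cvg_innerr (f : I -> H) x y :
  f @ F --> x -> (fun i => inner y (f i) : R[i]^o) @ F --> (inner y x : R[i]^o).
Proof.
move=> fx; apply/cvgrPdist_le => /= e e0.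
have /cvgrPdist_le /(_ e e0) := cvg_innerl (y := y) fx; apply: filterS => i.
by rewrite -innerBl -innerBr [in X in _ -> X]innerC norm_conjC.
Qed.

End cvg_inner.

Lemma adjoint_sym S T : is_adjoint S T -> is_adjoint T S.
Proof. by move=> ST x y; rewrite innerC -ST -innerC. Qed.

Lemma adjoint_linear S T : is_adjoint S T -> linear S.
Proof.
move=> ST a x y; apply: innerI => z.
by rewrite ST !innerDl !innerZl !ST.
Qed.

Lemma adjoint_unique S T T' : is_adjoint S T -> is_adjoint S T' -> T = T'.
Proof.
move=> /adjoint_sym ST /adjoint_sym ST'; apply/funext => x.
by apply: innerI => z; rewrite ST ST'.
Qed.

Lemma adjoint_comp S T S' T' :
  is_adjoint S S' -> is_adjoint T T' -> is_adjoint (S \o T) (T' \o S').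
Proof. by move=> SS TT x y /=; rewrite SS TT. Qed.

Lemma adjoint_iter S T n : is_adjoint S T -> is_adjoint (iter n S) (iter n T).
Proof. by move=> ST; elim: n => // n IH x y /=; rewrite ST IH -iterS iterSr. Qed.

(** Polarization: expanding the norm of [x + y] settles [<x, y> + <y, x>], and replacing [x] by
    ['i *: x] settles [<x, y> - <y, x>]. *)
Lemma isometry_inner S : is_isometry S -> forall x y, inner (S x) (S y) = inner x y.
Proof.
move=> [lS nS].
have E x y : inner (S x) (S y) + inner (S y) (S x) = inner x y + inner y x.
  have : inner (S (x + y)) (S (x + y)) = inner (x + y) (x + y).
    by rewrite -!normr_inner nS.
  rewrite (linD lS) !innerDl !innerDr -!normr_inner !nS.
  by rewrite !addrA => /addIr; rewrite -!addrA => /addrI.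
move=> x y; have := E ('i *: x) y.
rewrite (linZ lS) !innerZl !innerZr.
rewrite conjCi !mulNr -!mulrBr => /mulfI -/(_ (neq0Ci _)) E'.
have : inner (S x) (S y) *+ 2 = inner x y *+ 2.
  have dbl (a b : R[i]) : a *+ 2 = (a + b) + (a - b).
    by rewrite addrACA subrr addr0 mulr2n.
  rewrite (dbl _ (inner (S y) (S x))) (dbl (inner x y) (inner y x)).
  by rewrite E E'.
by move/eqP; rewrite eqrMn2r => /eqP.
Qed.

Lemma isometry_adjointK S S' : is_isometry S -> is_adjoint S S' -> cancel S S'.
Proof.
move=> iS aS x; apply: innerI => y.
by rewrite (adjoint_sym aS) (isometry_inner iS).
Qed.

Lemma isometry_iter S n : is_isometry S -> is_isometry (iter n S).
Proof.
move=> [lS nS]; split; first exact: linear_iter.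
by elim: n => // n IH x /=; rewrite nS.
Qed.

End hilbert.

(** * The C*-algebra of bounded adjointable operators *)

Section adjointable_operators.
Variables (R : realType) (H : hilbertType R).
Implicit Types (T : H -> H).
Local Open Scope complex_scope.

Definition opbound T : set R[i] :=
  [set c | 0 <= c /\ forall x, `|T x| <= c * `|x|].

(** Norms take values in [R[i]], whose order is only partial, so the infimum is formed over real
    parts and embedded back. *)
Definition opnorm T : R[i] := (inf [set complex.Re c | c in opbound T])%:C.

Lemma opnorm_le T c : opbound T c -> opnorm T <= c.
Proof.
move=> bc; have [c0 _] := bc.
rewrite -(RRe_real (ger0_real c0)) lecR; apply: ge_inf; last by exists c.
exists 0 => _ [d [d0 _] <-].
by rewrite -ler0c RRe_real // ger0_real.
Qed.

Lemma opnorm_bound T : opbound T !=set0 -> opbound T (opnorm T).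
Proof.
move=> [c bc]; have ne : [set complex.Re c | c in opbound T] !=set0.
  by exists (complex.Re c), c.
split.
  rewrite ler0c; apply: lb_le_inf => // _ [d [d0 _] <-].
  by rewrite -ler0c RRe_real // ger0_real.
move=> x; have [->|x0] := eqVneq x 0.
  by have := bc.2 0; rewrite !normr0 !mulr0.
rewrite -ler_pdivrMr ?normr_gt0 //.
have q0 : 0 <= `|T x| / `|x| by rewrite divr_ge0.
rewrite -(RRe_real (ger0_real q0)) lecR.
apply: lb_le_inf => // _ [d [d0 bd] <-].
by rewrite -lecR !RRe_real ?ger0_real // ler_pdivrMr ?normr_gt0.
Qed.

(* Asking for an adjoint dispenses with the Riesz representation theorem. *)
Definition adjointable : {pred H -> H} :=
  [pred T | `[< opbound T !=set0 /\ exists T', is_adjoint T T' >]].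

Lemma adjointableP T :
  reflect (opbound T !=set0 /\ exists T', is_adjoint T T') (T \in adjointable).
Proof. exact: asboolP. Qed.

Lemma adjointable_submod : GRing.submod_closed adjointable.
Proof.
split.
  apply/adjointableP; split; first by exists 0; split=> // x; rewrite normr0 mul0r.
  by exists 0 => x y; rewrite inner0l inner0r.
move=> a S T /adjointableP[[c [c0 bc]] [S' aS]] /adjointableP[[d [d0 bd]] [T' aT]].
apply/adjointableP; split.
  exists (`|a| * c + d); split; first by rewrite addr_ge0 ?mulr_ge0.
  move=> x; rewrite mulrDl (le_trans (ler_normD _ _)) // lerD // normrZ -mulrA.
  exact: ler_wpM2l.
exists (Num.conj a *: S' + T') => x y.
change (inner (a *: S x + T x) y = inner x (Num.conj a *: S' y + T' y)).
by rewrite innerDl innerDr innerZl innerZr conjCK aS aT.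
Qed.

HB.instance Definition _ :=
  GRing.isSubmodClosed.Build _ _ adjointable adjointable_submod.

Record adjop := Adjop { opval :> H -> H; _ : opval \in adjointable }.

HB.instance Definition _ := [isSub for opval].
HB.instance Definition _ := [Choice of adjop by <:].
HB.instance Definition _ := [SubChoice_isSubLmodule of adjop by <:].

Implicit Types A B : adjop.

Lemma adjop_eq A B : A =1 B -> A = B.
Proof. by move=> AB; apply: val_inj; apply/funext. Qed.

Lemma adjopD A B x : (A + B) x = A x + B x. Proof. by []. Qed.
Lemma adjopZ l A x : (l *: A) x = l *: A x. Proof. by []. Qed.

Lemma adjop_bound A : opbound A (opnorm A).
Proof. by have /adjointableP[bA _] := valP A; apply: opnorm_bound. Qed.

Lemma opnorm_ge0 A : 0 <= opnorm A. Proof. exact: (adjop_bound A).1. Qed.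
Lemma opnormP A x : `|A x| <= opnorm A * `|x|. Proof. exact: (adjop_bound A).2. Qed.

Lemma opnormD A B : opnorm (A + B) <= opnorm A + opnorm B.
Proof.
apply: opnorm_le; split; first by rewrite addr_ge0 ?opnorm_ge0.
move=> x; rewrite adjopD mulrDl.
by rewrite (le_trans (ler_normD _ _)) // lerD ?opnormP.
Qed.

Lemma opnormZ_le l A : opnorm (l *: A) <= `|l| * opnorm A.
Proof.
apply: opnorm_le; split; first by rewrite mulr_ge0 ?opnorm_ge0.
by move=> x; rewrite adjopZ normrZ -mulrA ler_wpM2l ?opnormP.
Qed.

Lemma opnormZ l A : opnorm (l *: A) = `|l| * opnorm A.
Proof.
apply/eqP; rewrite eq_le opnormZ_le andTb.
have [->|l0] := eqVneq l 0; first by rewrite normr0 mul0r opnorm_ge0.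
rewrite mulrC -ler_pdivlMr ?normr_gt0 // mulrC -normfV.
by rewrite -{1}[A](scalerK l0) opnormZ_le.
Qed.

Lemma opnorm0_eq0 A : opnorm A = 0 -> A = 0.
Proof.
move=> A0; apply: adjop_eq => x; apply/eqP.
by rewrite -normr_le0 (le_trans (opnormP _ _)) // A0 mul0r.
Qed.

HB.instance Definition _ :=
  Lmodule_isNormed.Build R[i] adjop opnormD opnormZ opnorm0_eq0.

Lemma adjop_normP A x : `|A x| <= `|A| * `|x|. Proof. exact: opnormP. Qed.

Lemma adjop_norm_le A c : 0 <= c -> (forall x, `|A x| <= c * `|x|) -> `|A| <= c.
Proof. by move=> c0 bc; apply: opnorm_le. Qed.

Lemma comp_adjointable A B : (A \o B : H -> H) \in adjointable.
Proof.
have /adjointableP[[c [c0 bc]] [S' aS]] := valP A.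
have /adjointableP[[d [d0 bd]] [T' aT]] := valP B.
apply/adjointableP; split; last by exists (T' \o S'); exact: adjoint_comp.
exists (c * d); split=> [|x /=]; first exact: mulr_ge0.
by rewrite (le_trans (bc _)) // -mulrA ler_wpM2l.
Qed.

Lemma id_adjointable : (id : H -> H) \in adjointable.
Proof.
apply/adjointableP; split; last by exists id.
by exists 1; split=> // x; rewrite mul1r.
Qed.

Lemma adjop_adjoint A : exists A' : H -> H, is_adjoint A A'.
Proof. by have /adjointableP[] := valP A. Qed.

Definition adjfun A : H -> H := projT1 (cid (adjop_adjoint A)).

Lemma adjfunP A : is_adjoint A (adjfun A).
Proof. exact: (projT2 (cid (adjop_adjoint A))). Qed.

(** With [A'] the adjoint, [|A' x|^2 = <A A' x, x> <= |A| |A' x| |x|], and a nonzero [|A' x|]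
    cancels. *)
Lemma adjfun_bound A x : `|adjfun A x| <= `|A| * `|x|.
Proof.
have [->|nz] := eqVneq (adjfun A x) 0; first by rewrite normr0 mulr_ge0.
rewrite -(ler_pM2l (_ : 0 < `|adjfun A x|)) ?normr_gt0 // -expr2 normr_inner.
rewrite -adjfunP -[leLHS]ger0_norm; last by rewrite adjfunP -normr_inner exprn_ge0.
rewrite (le_trans (cauchy_schwarz _ _)) // mulrA ler_wpM2r // mulrC.
exact: adjop_normP.
Qed.

Lemma adjfun_adjointable A : adjfun A \in adjointable.
Proof.
apply/adjointableP; split; last by exists A; apply/adjoint_sym/adjfunP.
by exists `|A|; split=> //; exact: adjfun_bound.
Qed.

Definition adjop_one : adjop := Adjop id_adjointable.
Definition adjop_mul A B : adjop := Adjop (comp_adjointable A B).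
Definition adjop_star A : adjop := Adjop (adjfun_adjointable A).

Lemma adjop_starP A : is_adjoint A (adjop_star A).
Proof. exact: adjfunP. Qed.

Lemma adjop_starE A B : is_adjoint A B -> adjop_star A = B.
Proof. by move=> AB; apply: val_inj; exact: adjoint_unique (adjop_starP A) AB. Qed.

Lemma adjop_linear A : linear A.
Proof. exact: adjoint_linear (adjop_starP A). Qed.

Lemma adjop_mulA : associative adjop_mul.
Proof. by move=> A B C; exact: adjop_eq. Qed.

Lemma adjop_mul1l : left_id adjop_one adjop_mul.
Proof. by move=> A; exact: adjop_eq. Qed.

Lemma adjop_mul1r : right_id adjop_one adjop_mul.
Proof. by move=> A; exact: adjop_eq. Qed.

Lemma adjop_mulDl : left_distributive adjop_mul +%R.
Proof. by move=> A B C; exact: adjop_eq. Qed.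

Lemma adjop_mulZl l A B : adjop_mul (l *: A) B = l *: adjop_mul A B.
Proof. exact: adjop_eq. Qed.

Lemma adjop_mulDr : right_distributive adjop_mul +%R.
Proof. by move=> A B C; apply: adjop_eq => x; exact: (linD (adjop_linear A)). Qed.

Lemma adjop_mulZr l A B : adjop_mul A (l *: B) = l *: adjop_mul A B.
Proof. by apply: adjop_eq => x; exact: (linZ (adjop_linear A)). Qed.

Lemma adjop_starK : involutive adjop_star.
Proof. by move=> A; apply/adjop_starE/adjoint_sym/adjop_starP. Qed.

Lemma adjop_starD : {morph adjop_star : A B / A + B}.
Proof.
move=> A B; apply: adjop_starE => x y.
by rewrite !adjopD innerDl innerDr !adjop_starP.
Qed.

Lemma adjop_starZ l A : adjop_star (l *: A) = Num.conj l *: adjop_star A.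
Proof.
by apply: adjop_starE => x y; rewrite !adjopZ innerZl innerZr conjCK adjop_starP.
Qed.

Lemma adjop_starM A B : adjop_star (adjop_mul A B) = adjop_mul (adjop_star B) (adjop_star A).
Proof. by apply: adjop_starE; apply: adjoint_comp; exact: adjop_starP. Qed.

Lemma adjop_normM A B : `|adjop_mul A B| <= `|A| * `|B|.
Proof.
apply: adjop_norm_le => [|x /=]; first exact: mulr_ge0.
by rewrite (le_trans (adjop_normP _ _)) // -mulrA ler_wpM2l // adjop_normP.
Qed.

Lemma adjop_star_norm A : `|adjop_star A| = `|A|.
Proof.
have le B : `|adjop_star B| <= `|B|.
  by apply: adjop_norm_le => // x; exact: adjfun_bound.
by apply/eqP; rewrite eq_le le -{1}[A]adjop_starK le.
Qed.

Lemma adjop_cstar_identity A : `|adjop_mul (adjop_star A) A| = `|A| ^+ 2.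
Proof.
apply/eqP; rewrite eq_le; apply/andP; split.
  by rewrite (le_trans (adjop_normM _ _)) // adjop_star_norm expr2.
set N := `|_ : adjop|; have N0 : 0 <= N by exact: normr_ge0.
(* After taking square roots, [sqrtC N] has to bound [A], which holds because
   [|A x|^2 = <x, A^* A x> <= N |x|^2]. *)
rewrite -[leRHS]sqrtCK ler_sqr ?nnegrE ?sqrtC_ge0 //.
apply: adjop_norm_le => [|x]; first by rewrite sqrtC_ge0.
rewrite -ler_sqr ?nnegrE ?mulr_ge0 ?sqrtC_ge0 // exprMn sqrtCK normr_inner.
rewrite adjop_starP -[leLHS]ger0_norm; last first.
  by rewrite -adjop_starP -normr_inner exprn_ge0.
rewrite (le_trans (cauchy_schwarz _ _)) // expr2 mulrA mulrC ler_wpM2r //.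
exact: (adjop_normP (adjop_mul (adjop_star A) A)).
Qed.

End adjointable_operators.

(** * Completeness of the algebra of adjointable operators *)

Section complete.
Variables (R : realType) (H : hilbertType R).
Local Notation adjop := (adjop H).
Implicit Types A B : adjop.

Lemma cvg_norm_le (I : Type) (F : set_system I) (FF : ProperFilter F)
    (f : I -> H) (l a : H) (c : R[i]) :
  f @ F --> l -> (\forall i \near F, `|f i - a| <= c) -> `|l - a| <= c.
Proof.
move=> fl near_a; apply/ler_addgt0Pr => e e0.
move/cvgrPdist_le : fl => /(_ _ e0) near_l.
have [i [li ia]] := filter_ex (filterI near_l near_a).
rewrite -(subrK (f i) l) -addrA addrC (le_trans (ler_normD _ _)) //.
exact: lerD.
Qed.

Section cauchy_limit.
Variable F : set_system adjop.
Context {FF : ProperFilter F}.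
Hypothesis Fc : forall e : R[i], 0 < e -> exists A, F [set B | `|A - B| <= e].

(** A Lipschitz map preserves Cauchy filters. It is applied to [A x] and to [A^* x]; dividing by
    [m + 1] allows [m = 0]. *)
Lemma pointwise_cvg (phi : adjop -> H) (m : R[i]) : 0 <= m ->
  (forall A B, `|phi A - phi B| <= `|A - B| * m) -> cvg (phi @ F).
Proof.
move=> m0 phiB; apply: cauchy_cvg; apply: cauchy_exP => e e0.
have m1 : 0 < m + 1 by rewrite ltr_wpDl.
have [A FA] := Fc (divr_gt0 e0 m1).
exists (phi A); rewrite /nbhs /=; apply: filterS FA => B /= AB.
rewrite -ball_normE /= (le_lt_trans (phiB _ _)) //.
apply: le_lt_trans (_ : e / (m + 1) * m < _); first exact: ler_wpM2r.
by rewrite mulrAC ltr_pdivrMr // ltr_pM2l // ltrDl.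
Qed.

(** Limits are formed pointwise, for the operators and for their adjoints; the limit of
    [<A x, y> = <x, A^* y>] shows that the two limits are adjoint. The estimate survives because
    closed balls are closed. *)
Lemma adjop_limit : exists L : adjop, forall e A, F [set B | `|A - B| <= e] ->
  `|L - A| <= e.
Proof.
have cl x : cvg ((fun A : adjop => A x) @ F).
  apply: (@pointwise_cvg _ `|x|) => // A B.
  exact: (adjop_normP (A - B)).
have cl' x : cvg ((fun A : adjop => adjop_star A x) @ F).
  apply: (@pointwise_cvg _ `|x|) => // A B.
  rewrite -[`|A - B|]adjop_star_norm.
  have -> : adjop_star (A - B) = adjop_star A - adjop_star B.
    by rewrite adjop_starD -scaleN1r adjop_starZ rmorphN1 scaleN1r.
  exact: (adjop_normP (adjop_star A - adjop_star B)).
pose L x := lim ((fun A : adjop => A x) @ F).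
pose L' x := lim ((fun A : adjop => adjop_star A x) @ F).
have aL : is_adjoint L L'.
  move=> x y; have c1 := cvg_innerl (y := y) (cl x).
  have c2 := cvg_innerr (y := x) (cl' y).
  have E : (fun A : adjop => inner (A x) y : R[i]^o) =
           (fun A : adjop => inner x (adjop_star A y) : R[i]^o).
    by apply/funext => A; rewrite adjop_starP.
  rewrite E in c1.
  have hC : hausdorff_space (R[i]^o) by exact: norm_hausdorff.
  exact: (cvg_unique hC (c1 _) (c2 _)).
have Lle e A : F [set B | `|A - B| <= e] -> forall x, `|L x - A x| <= e * `|x|.
  move=> FA x; apply: cvg_norm_le (cl x) _; apply: filterS FA => B AB.
  rewrite distrC (le_trans (adjop_normP (A - B) x)) //.
  exact: ler_wpM2r.
have mL : L \in @adjointable R H.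
  apply/adjointableP; split; last by exists L'.
  have [A FA] := Fc ltr01.
  exists (1 + `|A|); split=> [|x]; first by rewrite addr_ge0.
  rewrite -(subrK (A x) (L x)) mulrDl (le_trans (ler_normD _ _)) // lerD //.
    exact: Lle.
  exact: adjop_normP.
exists (Adjop mL) => e A FA; apply: adjop_norm_le; last exact: Lle.
by have [B] := filter_ex FA; apply: le_trans.
Qed.

End cauchy_limit.

Lemma adjop_complete (F : set_system adjop) : ProperFilter F -> cauchy F -> cvg F.
Proof.
move=> FF /cauchyP Fc.
have Fc' (e : R[i]) : 0 < e -> exists A, F [set B | `|A - B| <= e].
  move=> e0; have [A FA] := Fc e e0; exists A; apply: filterS FA => B.
  by rewrite -ball_normE /= => /ltW.
have [L Lle] := adjop_limit Fc'.
apply/cvg_ex; exists L; apply/cvgrPdist_le => e e0.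
have e2 : 0 < e / 2 by rewrite divr_gt0.
have [A FA] := Fc' _ e2; apply: filterS (FA) => B AB /=.
rewrite -(subrK A L) -addrA (le_trans (ler_normD _ _)) // (splitr e).
by rewrite lerD // Lle.
Qed.

HB.instance Definition _ := Uniform_isComplete.Build adjop adjop_complete.

HB.instance Definition _ := @CompleteNormedModule_isCStar.Build R adjop
  (adjop_one H) (@adjop_mul R H) (@adjop_star R H)
  (@adjop_mulA R H) (@adjop_mul1l R H) (@adjop_mul1r R H)
  (@adjop_mulDl R H) (@adjop_mulDr R H) (@adjop_mulZl R H) (@adjop_mulZr R H)
  (@adjop_starK R H) (@adjop_starD R H) (@adjop_starZ R H) (@adjop_starM R H)
  (@adjop_normM R H) (@adjop_cstar_identity R H).

End complete.

(** * Wold decomposition of the two isometries *)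

Section cvg_hilbert.
Context {R : realType} {H : hilbertType R}.
Implicit Types (x y z : H) (S T : H -> H).

(** The adjoint stands in for continuity: [<S (f i), z> = <f i, T z>] tends to [<x, T z> = <S x, z>]
    and also to [<y, z>]. *)
Lemma adjoint_cvg (I : Type) (F : set_system I) {FF : ProperFilter F} S T
    (f g : I -> H) x y : is_adjoint S T ->
  (\forall i \near F, S (f i) = g i) -> f @ F --> x -> g @ F --> y -> S x = y.
Proof.
move=> aS Sfg fx gy; apply: innerI => z; rewrite aS.
have hC : hausdorff_space (R[i]^o) by exact: norm_hausdorff.
apply: (cvg_unique hC (cvg_innerl (y := T z) fx)).
apply: cvg_trans (cvg_innerl (y := z) gy); apply: near_eq_cvg.
by apply: filterS Sfg => i <-; rewrite aS.
Qed.

(** The [a n] decrease and are bounded below, so some [a N] is within [e^2] of the infimum; from [N]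
    on, [f] stays within [e] of [f N]. *)
Lemma cvg_of_decrements (f : nat -> H) (a : nat -> R[i]) :
  (forall n, 0 <= a n) ->
  (forall n m, (n <= m)%N -> `|f m - f n| ^+ 2 = a n - a m) -> cvg (f @ \oo).
Proof.
move=> a0 fa; apply: cauchy_cvg; apply: cauchy_exP => e e0.
pose b n := complex.Re (a n).
have ab n : a n = real_complex R (b n) by rewrite RRe_real // ger0_real.
have e2 : 0 < e ^+ 2 by rewrite exprn_gt0.
have eE : e ^+ 2 = real_complex R (complex.Re (e ^+ 2)).
  by rewrite RRe_real // gtr0_real.
have infb : has_inf (range b).
  split; first by exists (b 0%N), 0%N.
  by exists 0 => _ [n _ <-]; rewrite -ler0c -ab.
have Re0 : 0 < complex.Re (e ^+ 2) by rewrite -ltcR -eE.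
have [_ [N _ <-] bN] := inf_adherent Re0 infb.
exists (f N); exists N => // n /= Nn.
rewrite -ball_normE /= distrC -ltr_sqr ?nnegrE ?(ltW e0) //.
rewrite fa // !ab eE -rmorphB ltcR ltrBlDr (lt_le_trans bN) //.
by rewrite addrC lerD2l; apply: ge_inf; [exact: infb.2|exists n].
Qed.

End cvg_hilbert.

Section wold.
Context {R : realType} {H : hilbertType R}.
Implicit Types (x y z : H) (S T : H -> H).

Section one_isometry.
Variables S S' : H -> H.
Hypotheses (iS : is_isometry S) (aS : is_adjoint S S').
Local Notation K := (unitary_part_space S).

Lemma iterK n : cancel (iter n S) (iter n S').
Proof. exact: isometry_adjointK (isometry_iter n iS) (adjoint_iter n aS). Qed.

Lemma iter_projK n m x : (m <= n)%N ->
  iter m S (iter m S' (iter n S x)) = iter n S x.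
Proof. by move=> /subnKC <-; rewrite iterD iterK. Qed.

(** [S^n S'^n] is the projection onto the range of [S^n], so its fixed points are exactly that
    range. *)
Lemma unitary_partP x : K x <-> forall n, iter n S (iter n S' x) = x.
Proof.
split=> [Kx [//|n]|Sx n _]; last by exists (iter n S' x).
by have [w _ <-] := Kx n.+1 isT; rewrite iterK.
Qed.

Lemma unitary_part_isometry x : K x -> K (S x).
Proof.
move=> Kx [//|[|n]] _; first by exists x.
by have [w _ <-] := Kx n.+1 isT; exists w.
Qed.

Lemma unitary_partB x y : K x -> K y -> K (x - y).
Proof.
move=> /unitary_partP Kx /unitary_partP Ky; apply/unitary_partP => n.
rewrite (linB (linear_iter n (adjoint_linear (adjoint_sym aS)))).
by rewrite (linB (linear_iter n iS.1)) Kx Ky.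
Qed.

(* [lim] is a junk value unless the sequence converges, see [cuntz_proj_cvg]. *)
Definition unitary_proj x : H := lim ((fun n => iter n S (iter n S' x)) @ \oo).

Lemma iter_proj_adjoint n :
  is_adjoint (iter n S \o iter n S') (iter n S \o iter n S').
Proof.
by apply: adjoint_comp; [|apply: adjoint_sym]; exact: adjoint_iter.
Qed.

Lemma unitary_proj_id x : K x -> unitary_proj x = x.
Proof.
move=> /unitary_partP Kx; rewrite /unitary_proj (_ : (fun n => _) = cst x).
  exact: lim_cst.
by apply/funext => n; rewrite Kx.
Qed.

Hypothesis cvg_proj : forall x, cvg ((fun n => iter n S (iter n S' x)) @ \oo).

(** For [n >= m] the projection [S^m S'^m] fixes [S^n S'^n x], hence also the limit. *)
Lemma unitary_proj_in x : K (unitary_proj x).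
Proof.
apply/unitary_partP => m.
have near_id : \forall n \near \oo, (iter m S \o iter m S')
    (iter n S (iter n S' x)) = iter n S (iter n S' x).
  by exists m => // n /= mn; rewrite iter_projK.
exact: (adjoint_cvg (iter_proj_adjoint m) near_id (@cvg_proj x) (@cvg_proj x)).
Qed.

(** [<x, S^n S'^n y> = <S^n S'^n x, y> = <x, y>] for all [n]. With [unitary_proj_in], this makes
    [unitary_proj] the orthogonal projection onto [K]. *)
Lemma inner_unitary_proj x y : K x -> inner x (unitary_proj y) = inner x y.
Proof.
move=> /unitary_partP Kx.
have hC : hausdorff_space (R[i]^o) by exact: norm_hausdorff.
have c := cvg_innerr (y := x) (@cvg_proj y).
apply: (cvg_unique hC (c _)).
rewrite (_ : (fun n => _) = cst (inner x y : R[i]^o)); first exact: cvg_cst.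
by apply/funext => n; rewrite -(iter_proj_adjoint n x y) /= Kx.
Qed.

End one_isometry.

(** The relations of the Cuntz algebra [O_2]. Their symmetry lets each result on [S1] serve for [S0]
    as well. *)
Record cuntz_pair (S0 S1 S0' S1' : H -> H) : Prop := {
  cuntz_isometry0 : is_isometry S0;
  cuntz_isometry1 : is_isometry S1;
  cuntz_adjoint0 : is_adjoint S0 S0';
  cuntz_adjoint1 : is_adjoint S1 S1';
  cuntz_sum : forall x, S0 (S0' x) + S1 (S1' x) = x
}.

Lemma cuntz_pair_sym S0 S1 S0' S1' :
  cuntz_pair S0 S1 S0' S1' -> cuntz_pair S1 S0 S1' S0'.
Proof. by case=> *; split=> // x; rewrite addrC. Qed.

(** At [S1 x] the sum relation reads [S0 S0' S1 x + S1 x = S1 x], and [S0] is injective. *)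
Lemma cuntz_orthogonal S0 S1 S0' S1' :
  cuntz_pair S0 S1 S0' S1' -> forall x, S0' (S1 x) = 0.
Proof.
case=> i0 i1 a0 a1 sum x; apply/eqP; rewrite -normr_eq0 -i0.2 normr_eq0.
have := sum (S1 x); rewrite (isometry_adjointK i1 a1) => /eqP.
by rewrite -subr_eq0 addrK.
Qed.

(* X = S0, Y = S1 gives the shift part of U, and X = S1, Y = S0 gives the
   projection onto the shift part of S1; in both cases Z' = S0', W' = S1'. *)
Definition wold_sum (X Y Z' W' : H -> H) n x :=
  \sum_(k < n) iter k X (Y (Z' (iter k W' x))).

(** * Convergence of the Wold sums *)

Section cuntz.
Variables S0 S1 S0' S1' : H -> H.
Hypothesis SS : cuntz_pair S0 S1 S0' S1'.

Lemma cuntz_norm x : `|S0' x| ^+ 2 + `|S1' x| ^+ 2 = `|x| ^+ 2.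
Proof.
rewrite !normr_inner -(cuntz_adjoint0 (cuntz_pair_sym SS)).
by rewrite -(cuntz_adjoint0 SS) -innerDl addrC (cuntz_sum (cuntz_pair_sym SS)).
Qed.

(** The terms are pairwise orthogonal, and by [cuntz_norm] the [k]-th has squared norm
    [|S1'^k x|^2 - |S1'^(k+1) x|^2]. These telescope, as [cvg_of_decrements] requires. *)
Lemma wold_sum_cvg X Y : is_isometry X -> is_isometry Y ->
  (forall u v, inner (X u) (Y v) = 0) ->
  forall x, cvg (wold_sum X Y S0' S1' n x @[n --> \oo]).
Proof.
move=> iX iY XY x; pose t n := iter n X (Y (S0' (iter n S1' x))).
have XtX n k : (k < n)%N -> forall u, inner (t k) (iter n X u) = 0.
  move=> /subnKC <- u; rewrite addSnnS iterD.
  by rewrite (isometry_inner (isometry_iter k iX)) /= innerC XY rmorph0.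
have orth n m u : (m <= n)%N -> inner (wold_sum X Y S0' S1' m x) (iter n X u) = 0.
  elim: m => [|m IH] mn; first by rewrite /wold_sum big_ord0 inner0l.
  by rewrite /wold_sum big_ord_recr innerDl /= IH ?(ltnW mn) // add0r XtX.
apply: (@cvg_of_decrements _ _ _ (fun n => `|iter n S1' x| ^+ 2)) => [n|n m].
  by rewrite exprn_ge0.
elim: m => [|m IH]; first by rewrite leqn0 => /eqP ->; rewrite !subrr normr0 expr0n.
rewrite leq_eqVlt => /orP[/eqP <-|]; first by rewrite !subrr normr0 expr0n.
rewrite ltnS => nm; rewrite {1}/wold_sum big_ord_recr /= -/(wold_sum _ _ _ _ m x).
rewrite addrAC pythagoras; last by rewrite innerBl !orth // subrr.
rewrite IH // -addrA; congr (_ + _).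
rewrite (isometry_iter m iX).2 iY.2; set y := iter m S1' x.
by rewrite -(cuntz_norm y) addrC opprD addrA subrr add0r.
Qed.

(** Each step inserts [S0 S0' + S1 S1' = 1] between [S1^n] and [S1'^n], which splits off the term of
    index [n]. *)
Lemma wold_sum_unitary_proj n x :
  iter n S1 (iter n S1' x) = x - wold_sum S1 S0 S0' S1' n x.
Proof.
have l1 m := linear_iter m (cuntz_isometry1 SS).1.
elim: n => [|n IH]; first by rewrite /wold_sum big_ord0 subr0.
rewrite /wold_sum big_ord_recr /= opprD addrA -/(wold_sum _ _ _ _ n x) -IH.
apply/eqP; rewrite eq_sym subr_eq -iterS iterSr -(linD (l1 n)) addrC.
by rewrite (cuntz_sum SS).
Qed.

Lemma cuntz_proj_cvg x : cvg (iter n S1 (iter n S1' x) @[n --> \oo]).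
Proof.
have c : cvg (wold_sum S1 S0 S0' S1' n x @[n --> \oo]).
  apply: wold_sum_cvg; [exact: cuntz_isometry1 SS|exact: cuntz_isometry0 SS|].
  move=> u v; rewrite (cuntz_adjoint1 SS).
  by rewrite (cuntz_orthogonal (cuntz_pair_sym SS)) inner0r.
rewrite (_ : (fun n => _) = (fun n => x - wold_sum S1 S0 S0' S1' n x)).
  by apply: is_cvgB => //; exact: is_cvg_cst.
by apply/funext => n; rewrite wold_sum_unitary_proj.
Qed.

Lemma wold_shift_cvg x : cvg (wold_sum S0 S1 S0' S1' n x @[n --> \oo]).
Proof.
apply: wold_sum_cvg; [exact: cuntz_isometry0 SS|exact: cuntz_isometry1 SS|].
by move=> u v; rewrite (cuntz_adjoint0 SS) (cuntz_orthogonal SS) inner0r.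
Qed.

End cuntz.
End wold.

(** * The unitary operator U *)

Section swap.
Context {R : realType} {H : hilbertType R}.

(** [V] and [W] are total functions of which only the values on the unitary parts matter. Asked in
    both directions, the conditions make them mutually inverse there. Linearity of [swap] will come
    from its adjoint. *)
Record part_intertwiner (S T V W : H -> H) : Prop := {
  part_in : forall x, unitary_part_space S x -> unitary_part_space T (V x);
  part_intertwines : forall x, unitary_part_space S x -> V (S x) = T (V x);
  part_adjoint : forall x y, unitary_part_space S x -> unitary_part_space T y ->
    inner (V x) y = inner x (W y);
  part_cancel : forall x, unitary_part_space S x -> W (V x) = x
}.

Definition swap (S0 S1 S0' S1' V : H -> H) (x : H) : H :=
  lim (wold_sum S0 S1 S0' S1' n x @[n --> \oo]) + V (unitary_proj S1 S1' x).

(** The adjoint of [S0^k S1 S0' S1'^k] is [S1^k S0 S1' S0'^k]. *)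
Lemma wold_sum_adjoint (S0 S1 S0' S1' : H -> H) n : is_adjoint S0 S0' -> is_adjoint S1 S1' ->
  is_adjoint (wold_sum S0 S1 S0' S1' n) (wold_sum S1 S0 S1' S0' n).
Proof.
move=> a0 a1 x y; elim: n => [|n IH]; first by rewrite /wold_sum !big_ord0 inner0l inner0r.
rewrite /wold_sum !big_ord_recr innerDl innerDr /= -IH; congr (_ + _).
by rewrite (adjoint_iter n a0) a1 (adjoint_sym a0) (adjoint_iter n (adjoint_sym a1)).
Qed.

Section one_swap.
Variables S0 S1 S0' S1' V W : H -> H.
Hypothesis SS : cuntz_pair S0 S1 S0' S1'.
Hypotheses (hV : part_intertwiner S1 S0 V W) (hW : part_intertwiner S0 S1 W V).
Let i0 := cuntz_isometry0 SS.
Let i1 := cuntz_isometry1 SS.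
Let a0 := cuntz_adjoint0 SS.
Let a1 := cuntz_adjoint1 SS.
Let U := swap S0 S1 S0' S1' V.
Let P := unitary_proj S1 S1'.

Let proj_in x : unitary_part_space S1 (P x).
Proof. exact: (unitary_proj_in i1 a1 (cuntz_proj_cvg SS)). Qed.

(** Adjointness replaces linearity: [|V 0|^2 = <0, W (V 0)> = 0]. *)
Lemma part0 : V 0 = 0.
Proof.
have K0 : unitary_part_space S1 0.
  by rewrite -(subrr (P 0)); apply: (unitary_partB i1 a1); exact: proj_in.
apply/eqP; rewrite -normr_eq0 -sqrf_eq0 normr_inner.
by rewrite (part_adjoint hV) ?inner0l //; exact: (part_in hV).
Qed.

(** On the shift parts, adjointness of the finite sums passes to the limit. On the unitary parts,
    with projections [P] and [Q], [<V P x, y> = <V P x, Q y> = <P x, W Q y> = <x, W Q y>]. *)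
Lemma swap_adjoint : is_adjoint U (swap S1 S0 S1' S0' W).
Proof.
have SS' := cuntz_pair_sym SS.
move=> x y; rewrite innerDl innerDr; congr (_ + _).
  have hC : hausdorff_space (R[i]^o) by exact: norm_hausdorff.
  have c := cvg_innerl (y := y) (@wold_shift_cvg _ _ _ _ _ _ SS x).
  have c' := cvg_innerr (y := x) (@wold_shift_cvg _ _ _ _ _ _ SS' y).
  apply: (cvg_unique hC (c _)).
  rewrite (_ : (fun n => _) = (fun n => inner x (wold_sum S1 S0 S1' S0' n y) : R[i]^o)).
    exact: c'.
  by apply/funext => n; rewrite (wold_sum_adjoint n a0 a1).
set Q := unitary_proj S0 S0'.
have Qy : unitary_part_space S0 (Q y).
  exact: (unitary_proj_in i0 a0 (cuntz_proj_cvg SS')).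
have Px := proj_in x.
rewrite -(inner_unitary_proj i0 a0 (cuntz_proj_cvg SS') y (part_in hV Px)).
rewrite (part_adjoint hV) // innerC [RHS]innerC; congr (Num.conj _).
by rewrite (inner_unitary_proj i1 a1 (cuntz_proj_cvg SS)) //; exact: (part_in hW).
Qed.

Lemma lim_near_cst (f : nat -> H) x :
  cvg (f @ \oo) -> (\forall n \near \oo, f n = x) -> lim (f @ \oo) = x.
Proof.
move=> cf fx; have aid : @is_adjoint R H id id by [].
exact: (adjoint_cvg aid fx cf (cvg_cst x)).
Qed.

Lemma iter_adjoint1_S0 n x : (0 < n)%N -> iter n S1' (S0 x) = 0.
Proof.
case: n => // n _; rewrite iterSr (cuntz_orthogonal (cuntz_pair_sym SS)).
exact: (lin0 (linear_iter n (adjoint_linear (adjoint_sym a1)))).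
Qed.

(** As [S1' S0 = 0], the projection kills [S0 x] and only the term of index 0 survives, which is
    [S1 S0' S0 x = S1 x]. *)
Lemma swap_S0 x : U (S0 x) = S1 x.
Proof.
have z0 : S0' 0 = 0 by exact: lin0 (adjoint_linear (adjoint_sym a0)).
rewrite /U /swap [X in V X](_ : _ = 0); last first.
  apply: lim_near_cst; first exact: cuntz_proj_cvg SS _.
  exists 1%N => // n /= n0; rewrite iter_adjoint1_S0 //.
  exact: (lin0 (linear_iter n i1.1)).
rewrite part0 addr0; apply: lim_near_cst; first exact: wold_shift_cvg SS _.
exists 1%N => // -[//|n] _; rewrite /wold_sum big_ord_recl /=.
rewrite (isometry_adjointK i0 a0) big1 ?addr0 // => k _.
rewrite -[S1' _]iterS iter_adjoint1_S0 // z0 (lin0 i1.1).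
exact: (lin0 (linear_iter k.+1 i0.1)).
Qed.

(** [S0' S1 = 0] removes the term of index 0, and [S1' S1 = 1] turns term [k + 1] at [S1 x] into
    [S0] of term [k] at [x]. *)
Lemma wold_sum_S1 n x :
  wold_sum S0 S1 S0' S1' n.+1 (S1 x) = S0 (wold_sum S0 S1 S0' S1' n x).
Proof.
rewrite /wold_sum big_ord_recl /= (cuntz_orthogonal SS) (lin0 i1.1) add0r.
rewrite (lin_sum i0.1 n (fun k => iter k S0 (S1 (S0' (iter k S1' x))))).
by apply: eq_bigr => k _; rewrite -[S1' (iter _ _ _)]iterS [iter _ S1' _]iterSr (isometry_adjointK i1 a1).
Qed.

(** The shift part follows from [wold_sum_S1] in the limit, the other part from [P S1 = S1 P] and
    [V S1 = S0 V]. *)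
Lemma swap_S1 x : U (S1 x) = S0 (U x).
Proof.
rewrite /U /swap (linD i0.1); congr (_ + _).
  have c := @wold_shift_cvg _ _ _ _ _ _ SS.
  have := @c (S1 x); rewrite -cvg_shiftS => cS.
  by apply/esym/(adjoint_cvg a0 _ (c x) cS); apply: nearW => n; rewrite -wold_sum_S1.
rewrite -(part_intertwines hV); last exact: proj_in.
congr (V _).
have c := @cuntz_proj_cvg _ _ _ _ _ _ SS.
have := @c (S1 x); rewrite -cvg_shiftS => cS.
apply/esym/(adjoint_cvg a1 _ (c x) cS); apply: nearW => n.
by rewrite /= -[S1' (iter _ _ _)]iterS [iter n.+1 S1' _]iterSr (isometry_adjointK i1 a1).
Qed.

(** Writing [x = S1^(k+1) w] gives [S1'^k x = S1 w], which [S0'] kills, so every term of the shift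
    part vanishes. *)
Lemma swap_unitary_part x : unitary_part_space S1 x -> U x = V x.
Proof.
move=> Kx; rewrite /U /swap (unitary_proj_id i1 a1) //.
rewrite (_ : (fun n => _) = cst 0) ?lim_cst ?add0r //.
apply/funext => n; rewrite /wold_sum big1 // => k _.
have [w _ <-] := Kx k.+1 isT.
rewrite iterSr -iterSr /= (_ : iter k S1' _ = S1 w); last first.
  by rewrite -iterS iterSr (iterK i1 a1).
rewrite (cuntz_orthogonal SS) (lin0 i1.1); exact: (lin0 (linear_iter k i0.1)).
Qed.

End one_swap.

(* T = U' U - 1 satisfies T S0 = 0 and T S1 = S1 T, so that T = T S1^n S1'^n for
   all n and hence T = T P; and T vanishes on the unitary part of S1. *)
Lemma swapK (S0 S1 S0' S1' V W : H -> H) : cuntz_pair S0 S1 S0' S1' ->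
  part_intertwiner S1 S0 V W -> part_intertwiner S0 S1 W V ->
  cancel (swap S0 S1 S0' S1' V) (swap S1 S0 S1' S0' W).
Proof.
move=> SS hV hW x; have SS' := cuntz_pair_sym SS.
set U := swap _ _ _ _ V; set U' := swap _ _ _ _ W.
have aU : is_adjoint U U' by exact: swap_adjoint.
have lU := adjoint_linear aU; have lU' := adjoint_linear (adjoint_sym aU).
have [l0 l1] := ((cuntz_isometry0 SS).1, (cuntz_isometry1 SS).1).
pose T y := U' (U y) - y.
have aT : is_adjoint T T.
  by move=> y z; rewrite innerBl innerBr (adjoint_sym aU) aU.
have lT := adjoint_linear aT.
have T0 y : T (S0 y) = 0.
  by rewrite /T /U (swap_S0 SS hV) /U' (swap_S0 SS' hW) subrr.
have T1 y : T (S1 y) = S1 (T y).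
  by rewrite /T /U (swap_S1 SS hV) /U' (swap_S1 SS' hW) (linB l1).
have Tn n y : T (iter n S1 y) = iter n S1 (T y).
  by elim: n => //= n IH; rewrite T1 IH.
have TP n : T (iter n S1 (iter n S1' x)) = T x.
  elim: n => // n <-; rewrite [in LHS]iterSr !Tn /=; congr (iter n S1 _).
  by rewrite -[in RHS](cuntz_sum SS (iter n S1' x)) (linD lT) T0 add0r.
have c := @cuntz_proj_cvg _ _ _ _ _ _ SS x.
have TPx : T (unitary_proj S1 S1' x) = T x.
  by apply: (adjoint_cvg aT _ c (cvg_cst (T x))); apply: nearW.
have Px : unitary_part_space S1 (unitary_proj S1 S1' x).
  apply: (unitary_proj_in (cuntz_isometry1 SS) (cuntz_adjoint1 SS)).
  exact: cuntz_proj_cvg SS.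
apply/eqP; rewrite -subr_eq0 -/(T x) -TPx /T /U (swap_unitary_part _ SS) //.
rewrite /U' (swap_unitary_part _ SS'); last exact: (part_in hV).
by rewrite (part_cancel hV) // subrr.
Qed.

(** [W] is the given equivalence and [V] picks preimages under it; [W] preserves inner products,
    hence is injective, so [V] inverts it. *)
Lemma unitary_parts_intertwiners (S0 S1 S0' S1' : H -> H) : cuntz_pair S0 S1 S0' S1' ->
  unitary_parts_equivalent S0 S1 ->
  exists V W, part_intertwiner S1 S0 V W /\ part_intertwiner S0 S1 W V.
Proof.
move=> SS [W [[linW innW ontoW] WS]].
have [i0 a0] := (cuntz_isometry0 SS, cuntz_adjoint0 SS).
pose K0 := unitary_part_space S0; pose K1 := unitary_part_space S1.
(* The implication sits under the existential so that [choice] yields a total [V], with arbitrary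
   values off [K1]. *)
have preim y : exists x, K1 y -> K0 x /\ W x = y.
  have [Ky|nKy] := pselect (K1 y); last by exists 0.
  have : (W @` K0) y by rewrite ontoW.
  by move=> [x Kx <-]; exists x.
have [V Vp] := choice preim.
have W_in x : K0 x -> K1 (W x).
  by move=> Kx; rewrite /K1 -ontoW; exists x.
have VK x : K0 x -> V (W x) = x.
  move=> Kx; have [Kv Wv] := Vp _ (W_in _ Kx).
  (* With [z = V (W x) - x], [<V (W x), z> = <W x, W z> = <x, z>], so [<z, z> = 0]. *)
  apply/eqP; rewrite -subr_eq0 -normr_eq0 -sqrf_eq0 normr_inner innerBl.
  have KB : K0 (V (W x) - x) by exact: (unitary_partB i0 a0).
  by rewrite -(innW _ _ Kv KB) -(innW _ _ Kx KB) Wv subrr.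
have S0K := @unitary_part_isometry _ _ S0.
exists V, W; split; split.
- by move=> x /Vp[].
- move=> x /Vp[Kv Wv]; rewrite -{1}Wv -WS // VK //; exact: S0K.
- by move=> x y /Vp[Kv Wv] Ky; rewrite -innW // Wv.
- by move=> x /Vp[].
- exact: W_in.
- exact: WS.
- by move=> x y Kx /Vp[Kv Wv]; rewrite -{1}Wv innW.
- exact: VK.
Qed.

End swap.

(** * Representations of Q_2 *)

Lemma adjop_continuous (R : realType) (H : hilbertType R) (A : adjop H) : continuous A.
Proof.
move=> x; apply/cvgrPdist_le => e e0.
have A1 : 0 < `|A| + 1 by rewrite ltr_wpDl.
have e1 : 0 < e / (`|A| + 1) by rewrite divr_gt0.
have /cvgrPdist_le /(_ _ e1) := @cvg_id _ (nbhs x); apply: filterS => y xy.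
rewrite -(linB (adjop_linear A)) (le_trans (adjop_normP _ _)) //.
apply: le_trans (_ : (`|A| + 1) * (e / (`|A| + 1)) <= _).
  by rewrite ler_pM // lerDl.
by rewrite mulrC divfK // gt_eqF.
Qed.

Lemma isometry_adjointable (R : realType) (H : hilbertType R) (S S' : H -> H) :
  is_isometry S -> is_adjoint S S' -> S \in @adjointable R H.
Proof.
move=> [_ nS] aS; apply/adjointableP; split; last by exists S'.
by exists 1; split=> // x; rewrite nS mul1r.
Qed.

Lemma morphism_representation (R : realType) (A : cstarType R) (H : hilbertType R)
    (f : A -> adjop H) :
  star_morphism f -> is_representation (fun a => opval (f a)).
Proof.
move=> [lf fM f1 fs]; split.
- by move=> a; exact: adjop_linear.
- by move=> a; exact: adjop_continuous.
- by move=> l a b; rewrite lf.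
- by move=> a b; rewrite fM.
- by rewrite f1.
- by move=> a; rewrite fs; exact: adjop_starP.
Qed.

(** A unitary carrying [S] to [T] maps the range of [S^n] onto that of [T^n], hence one intersection
    onto the other; its restriction is the equivalence. *)
Lemma conjugate_unitary_parts (R : realType) (H : hilbertType R)
    (S T U W : H -> H) :
  linear W -> is_adjoint W U -> cancel U W -> cancel W U ->
  (forall x, W (S x) = T (W x)) -> unitary_parts_equivalent S T.
Proof.
move=> lW aW UK WK WS.
have UT x : U (T x) = S (U x) by rewrite -{1}(UK x) -WS WK.
have Wn n x : W (iter n S x) = iter n T (W x).
  by elim: n => //= n IH; rewrite WS IH.
have Un n x : U (iter n T x) = iter n S (U x).
  by elim: n => //= n IH; rewrite UT IH.
exists W; split=> //; split.
- by move=> l x y _ _; exact: lW.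
- by move=> x y _ _; rewrite aW WK.
- apply/seteqP; split=> [_ [x Kx <-] n n0|y Ky].
    by have [w _ <-] := Kx n n0; exists (W w).
  exists (U y) => // n n0.
  by have [w _ <-] := Ky n n0; exists (U w).
Qed.

(** [u^* s = u^* s u u^* = u^* u^2 s u^* = u s u^*]. *)
Lemma Q2_conjugation (R : realType) (A : cstarType R) (u s : A) :
  Q2_relations u s -> star u ** s = u ** s ** star u.
Proof.
move=> [ul ur _ su _].
rewrite -[in LHS](cmul1r s) -ur (cmulA s) su !cmulA.
by rewrite ul cmul1l.
Qed.

Lemma swap_Q2_relations (R : realType) (H : hilbertType R)
    (S0 S1 S0' S1' V W : H -> H) (SS : cuntz_pair S0 S1 S0' S1') :
  part_intertwiner S1 S0 V W -> part_intertwiner S0 S1 W V ->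
  exists v t : adjop H, [/\ Q2_relations v t, t = S0 :> (H -> H) & v ** t = S1 :> (H -> H)].
Proof.
move=> hV hW; have SS' := cuntz_pair_sym SS.
pose U := swap S0 S1 S0' S1' V; pose U' := swap S1 S0 S1' S0' W.
have aU : is_adjoint U U' by exact: swap_adjoint.
have UK : cancel U U' by exact: swapK.
have UK' : cancel U' U by exact: swapK.
have isoU : is_isometry U.
  split; first exact: adjoint_linear aU.
  by move=> x; apply: normr_eq_inner; rewrite aU UK.
pose v := Adjop (isometry_adjointable isoU aU).
pose t := Adjop (isometry_adjointable (cuntz_isometry0 SS) (cuntz_adjoint0 SS)).
have sv : star v = U' :> (H -> H) by exact: adjoint_unique (adjop_starP v) aU.
have st : star t = S0' :> (H -> H).
  exact: adjoint_unique (adjop_starP t) (cuntz_adjoint0 SS).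
have vt x : U (S0 x) = S1 x by exact: (swap_S0 SS hV).
exists v, t; split=> //; last exact/funext.
split; apply: adjop_eq => x.
- by change (star v (U x) = x); rewrite sv UK.
- by change (U (star v x) = x); rewrite sv UK'.
- change (star t (S0 x) = x); rewrite st.
  exact: (isometry_adjointK (cuntz_isometry0 SS) (cuntz_adjoint0 SS)).
(* [U U S0 = U S1 = S0 U]. *)
- by change (S0 (U x) = U (U (S0 x))); rewrite vt; exact/esym/(swap_S1 SS hV).
- change (S0 (star t x) + U (S0 (star t (star v x))) = x); rewrite st sv vt.
  rewrite -[RHS](cuntz_sum SS); congr (_ + S1 _).
  (* What remains is [S0' U' = S1'], the adjoint of [U S0 = S1]. *)
  apply: innerI => z; rewrite (adjoint_sym (cuntz_adjoint0 SS)) (adjoint_sym aU).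
  by rewrite vt (adjoint_sym (cuntz_adjoint1 SS)).
Qed.

Theorem proposition4p1 (R : realType)
    (Q2 : cstarType R) (u s2 : Q2) (hQ2 : is_Q2 u s2)
    (H : hilbertType R) (S0 S1 S0' S1' : H -> H)
    (hS0 : is_isometry S0) (hS1 : is_isometry S1)
    (hS0' : is_adjoint S0 S0') (hS1' : is_adjoint S1 S1')
    (hsum : forall x : H, S0 (S0' x) + S1 (S1' x) = x) :
  (exists pi : Q2 -> H -> H,
     [/\ is_representation pi, pi s2 = S0 & pi (u ** s2) = S1])
  <-> unitary_parts_equivalent S0 S1.
Proof.
have [rel _ univ] := hQ2; split.
  move=> [pi [rep pi0 pi1]].
  have piM a b x : pi (a ** b) x = pi a (pi b x) by rewrite (representationM rep).
  have pi_id x : pi cone x = x by rewrite (representation1 rep).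
  apply: (@conjugate_unitary_parts _ _ _ _ (pi u) (pi (star u))).
  - exact: representation_op_linear rep _.
  - exact/adjoint_sym/(representation_star rep).
  - by move=> x; rewrite -piM (Q2_unitaryl rel) pi_id.
  - by move=> x; rewrite -piM (Q2_unitaryr rel) pi_id.
  - by move=> x; rewrite -pi0 -pi1 -!piM (Q2_conjugation rel).
have SS : cuntz_pair S0 S1 S0' S1' by [].
move=> /(unitary_parts_intertwiners SS) [V [W [hV hW]]].
have [v [t [relvt tS0 vtS1]]] := swap_Q2_relations SS hV hW.
have [f [mf fu fs]] := univ _ v t relvt.
exists (fun a => opval (f a)); split; first exact: morphism_representation.
- by rewrite fs.
- by rewrite (star_morphismM mf) fu fs.
Qed.
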